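(* Let $R$ be a domain with $(R:\widehat R)\neq\{0\}$ and let $r$ be an ideal system on $R$ such that $R$ is $r$-Noetherian and $r\text{-}\max(R)=\mathfrak X(R)$. Set $\mathcal P=\{\mathfrak p\in\mathfrak X(R)\mid\mathfrak p\not\supset(R:\widehat R)\}$, $\mathcal P^*=\mathfrak X(R)\setminus\mathcal P$, and let $T$ be the subsemigroup (with identity $R$) of $\mathcal I_r(R)$ generated by $\{I\in\mathcal A(\mathcal I_r(R))\mid\sqrt I\in\mathcal P^*\}$. Then: 1. $T$ is a monoid and $\mathcal I_r(R)\cong\mathcal F(\mathcal P)\times T$. 2. $T$ is finitely generated if and only if $\{I\in\mathcal A(\mathcal I_r(R))\mid\sqrt I\in\mathcal P^*\}$ is finite.
   Context: Let $R$ be a domain with quotient field $K$, $R^\bullet=R\setminus\{0\}$. An ideal system on $R$ is given by a map $r'$ from subsets of $R^\bullet$ to subsets of $R^\bullet$ such that for all $X,Y\subset R^\bullet$, $c\in R^\bullet$: $X\subset X_{r'}$; $X\subset Y_{r'}$ implies $X_{r'}\subset Y_{r'}$; $cR^\bullet\subset\{c\}_{r'}$; $cX_{r'}=(cX)_{r'}$; for $X\subset R$ one puts $X_r=(X\setminus\{0\})_{r'}\cup\{0\}$. A subset $I\subset R$ is an $r$-ideal if $I_r=I$. Standing assumption: every nonzero $r$-ideal is an ordinary ring ideal of $R$. $\mathcal I_r(R)$ is the set of nonzero $r$-ideals, a commutative semigroup with identity $R$ under $(I,J)\mapsto(IJ)_r$; its only unit is $R$. $R$ is $r$-Noetherian if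 the ascending chain condition on $r$-ideals holds. $r\text{-}\max(R)$ is the set of maximal elements of the set of nonzero proper $r$-ideals; $\mathfrak X(R)$ is the set of minimal nonzero prime ideals of $R$ (both empty if $R$ is a field). $\sqrt I$ is the radical. $\widehat R=\{x\in K\mid\exists\,c\in R^\bullet\ \forall n\in\mathbb N:\ cx^n\in R\}$ is the complete integral closure; $(R:\widehat R)=\{x\in K\mid x\widehat R\subset R\}$. $\mathcal A(\mathcal I_r(R))$ is the set of atoms: $I\in\mathcal I_r(R)$, $I\ne R$, such that $I=(JL)_r$ with $J,L\in\mathcal I_r(R)$ implies $J=R$ or $L=R$. A monoid is a commutative semigroup with identity which is unit-cancellative: $a=au$ implies that $u$ is invertible. $\mathcal F(\mathcal P)$ is the free abelian monoid with basis $\mathcal P$. *)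

(* Defs.v *)
From HB Require Import structures.
From mathcomp Require Import all_boot all_order all_algebra.
From mathcomp Require Import finmap multiset.
From mathcomp Require Import boolp classical_sets functions cardinality.

Set Implicit Arguments.
Unset Strict Implicit.
Unset Printing Implicit Defensive.

Import GRing.Theory.

Local Open Scope classical_set_scope.
Local Open Scope ring_scope.

Section Monoids.

Local Open Scope group_scope.

(* [monoidType] only asks for associativity and an identity; a monoid in the
   sense of factorization theory is also commutative and unit-cancellative. *)
Definition unit_cancellative_monoid (M : monoidType) : Prop :=
  commutative (fun x y : M => x * y) /\
  forall a u : M, a = a * u -> exists v : M, u * v = 1.

Definition monoid_isomorphic (M N : monoidType) : Prop :=
  exists2 f : M -> N, bijective f & monoid.monoid_morphism f.

Definition submonoid_span (M : monoidType) (G : set M) : set M :=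
  smallest (fun A : set M => monoid_closed [in A]) G.

Definition finitely_generated (M : monoidType) : Prop :=
  exists2 G : set M, finite_set G & submonoid_span G = [set: M].

(* [submonoid_span G] as a monoid in its own right. *)
Definition submonoid (M : monoidType) (G : set M) : Type :=
  set_type (submonoid_span G).

Fact submonoid_span_closed (M : monoidType) (G : set M) :
  monoid_closed [in submonoid_span G].
Proof.
split; first by apply/mem_set => A /= [[/set_mem A1 _] _].
move=> x y /set_mem Sx /set_mem Sy; apply/mem_set => A /= [[A1 AM] GA].
by apply/set_mem/AM; apply/mem_set; [apply: Sx | apply: Sy].
Qed.

HB.instance Definition _ (M : monoidType) (G : set M) :=
  SubChoice.on (submonoid G).
HB.instance Definition _ (M : monoidType) (G : set M) :=
  SubChoice_isSubMonoid.Build M [in submonoid_span G] (submonoid G)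
    (submonoid_span_closed G).

(* The free abelian monoid with basis B: finite multisets under the sum. *)
Definition free_abelian_monoid (B : choiceType) : Type := multiset B.

HB.instance Definition _ (B : choiceType) :=
  Choice.copy (free_abelian_monoid B) (multiset B).

Fact mset0D (B : choiceType) :
  left_id (mset0 : free_abelian_monoid B) (@msetD B).
Proof. by move=> A; rewrite msetDC msetD0. Qed.

HB.instance Definition _ (B : choiceType) :=
  isMonoid.Build (free_abelian_monoid B)
    (@msetDA B) (@mset0D B) (@msetD0 B).

End Monoids.

Section RingIdeals.

Variable R : idomainType.

Definition nonzero : set R := [set x | x != 0].

Definition ring_ideal (I : set R) : Prop :=
  submod_closed ([in I] : {pred R^o}).

(* [idealr_closed] excludes the unit ideal. *)
Definition prime_ideal (I : set R) : Prop :=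
  idealr_closed [in I] /\ prime_idealr_closed [in I].

Definition minimal_elements (C : set (set R)) : set (set R) :=
  [set I | C I /\ forall J, C J -> J `<=` I -> J = I].

Definition maximal_elements (C : set (set R)) : set (set R) :=
  [set I | C I /\ forall J, C J -> I `<=` J -> J = I].

Definition minimal_primes : set (set R) :=
  minimal_elements [set p | prime_ideal p /\ p <> [set 0]].

Definition radical (I : set R) : set R :=
  [set x | exists2 n : nat, (0 < n)%N & I (x ^+ n)].

Definition complete_integral_closure : set {fraction R} :=
  [set x | exists2 c : R, c != 0 &
             forall n : nat, range (@tofrac R) (tofrac c * x ^+ n)].

Definition conductor : set {fraction R} :=
  [set x | forall y, complete_integral_closure y ->
             range (@tofrac R) (x * y)].

End RingIdeals.

Arguments nonzero {R}.

(* Only the values of [pclosure] on sets of nonzero elements are constrained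
   (and used below), so this is a map from subsets of R \ {0} to themselves. *)
Record ideal_system (R : idomainType) := IdealSystem {
  pclosure : set R -> set R;
  pclosure_nonzero : forall X : set R,
    X `<=` nonzero -> pclosure X `<=` nonzero;
  pclosure_ext : forall X : set R, X `<=` nonzero -> X `<=` pclosure X;
  pclosure_trans : forall X Y : set R, X `<=` nonzero -> Y `<=` nonzero ->
    X `<=` pclosure Y -> pclosure X `<=` pclosure Y;
  pclosure_principal : forall c : R, c != 0 ->
    ( *%R c) @` nonzero `<=` pclosure [set c];
  pclosure_scale : forall (c : R) (X : set R), c != 0 -> X `<=` nonzero ->
    ( *%R c) @` pclosure X = pclosure (( *%R c) @` X)
}.

Section RIdeals.

Variables (R : idomainType) (r : ideal_system R).

Implicit Types X Y Z I J : set R.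

Definition r_closure X : set R := pclosure r (X `\ 0) `|` [set 0].

Definition r_ideal I : Prop := r_closure I = I.

Definition nonzero_r_ideal : set (set R) :=
  [set I | r_ideal I /\ I <> [set 0]].

Definition r_noetherian : Prop :=
  forall I : nat -> set R, (forall n, r_ideal (I n)) ->
    (forall n, I n `<=` I n.+1) ->
    exists N, forall n, (N <= n)%N -> I n = I N.

Definition r_max : set (set R) :=
  maximal_elements [set I | nonzero_r_ideal I /\ I <> [set: R]].

(* Elementwise products, not sums of products: the r-closure of either is the
   same as soon as nonzero r-ideals are ring ideals. *)
Definition set_mul X Y : set R := [set x * y | x in X & y in Y].

Fact nonzeroD X : X `\ 0 `<=` nonzero.
Proof. by move=> x [_ /eqP]. Qed.

Fact nonzero_set_mul X Y :
  X `<=` nonzero -> Y `<=` nonzero -> set_mul X Y `<=` nonzero.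
Proof.
by move=> nX nY _ [x Xx [y Yy <-]]; apply: mulf_neq0; [apply: nX | apply: nY].
Qed.

Fact set_mulC : commutative set_mul.
Proof.
move=> X Y; apply/seteqP; split=> _ [x Xx [y Yy <-]]; rewrite mulrC;
  by exists y => //; exists x.
Qed.

Fact set_mulA : associative set_mul.
Proof.
move=> X Y Z; apply/seteqP; split.
  move=> _ [x Xx [_ [y Yy [z Zz <-]] <-]]; rewrite mulrA.
  by exists (x * y); [exists x => //; exists y | exists z].
move=> _ [_ [x Xx [y Yy <-]] [z Zz <-]]; rewrite -mulrA.
by exists x => //; exists (y * z) => //; exists y => //; exists z.
Qed.

Fact set_mulD X Y : set_mul X Y `\ 0 = set_mul (X `\ 0) (Y `\ 0).
Proof.
apply/seteqP; split.
  move=> _ [[x Xx [y Yy <-]] /eqP]; rewrite /= mulf_eq0 negb_or.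
  move=> /andP[/eqP x0 /eqP y0].
  by exists x => //; exists y.
move=> z Dz; split; last first.
  by apply/eqP; apply: nonzero_set_mul Dz; apply: nonzeroD.
by case: Dz => x [Xx _] [y [Yy _] <-]; exists x => //; exists y.
Qed.

Fact pclosure_mono X Y :
  Y `<=` nonzero -> X `<=` Y -> pclosure r X `<=` pclosure r Y.
Proof.
move=> nY sXY; apply: pclosure_trans => //; first exact: subset_trans nY.
by apply: subset_trans sXY _; apply: pclosure_ext.
Qed.

Fact pclosure_idem X :
  X `<=` nonzero -> pclosure r (pclosure r X) = pclosure r X.
Proof.
move=> nX; have ncX := pclosure_nonzero (i := r) nX.
by apply/seteqP; split; [apply: pclosure_trans | apply: pclosure_ext].
Qed.

Fact pclosure_mul X Y : X `<=` nonzero -> Y `<=` nonzero ->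
  pclosure r (set_mul X (pclosure r Y)) = pclosure r (set_mul X Y).
Proof.
move=> nX nY; have ncY := pclosure_nonzero (i := r) nY.
have nXY := nonzero_set_mul nX nY; have nXcY := nonzero_set_mul nX ncY.
apply/seteqP; split; last first.
  apply: pclosure_mono => // _ [x Xx [y Yy <-]].
  by exists x => //; exists y => //; apply: pclosure_ext.
apply: pclosure_trans => // _ [x Xx [y cYy <-]].
have: ( *%R x @` pclosure r Y) (x * y) by exists y.
rewrite pclosure_scale //; last exact: nX.
by apply: pclosure_mono => // _ [z Yz <-]; exists x => //; exists z.
Qed.

Fact r_closureD X : r_closure X `\ 0 = pclosure r (X `\ 0).
Proof.
apply/seteqP; split=> [x [[//|-> []//]]|x cx]; split; first by left.
by apply/eqP; apply: pclosure_nonzero cx; apply: nonzeroD.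
Qed.

Fact r_closure_eq X Y : X `\ 0 = Y `\ 0 -> r_closure X = r_closure Y.
Proof. by rewrite /r_closure => ->. Qed.

Fact r_closure_ideal X : r_ideal (r_closure X).
Proof.
by rewrite /r_ideal {1}/r_closure r_closureD pclosure_idem //; apply: nonzeroD.
Qed.

Fact r_ideal0 I : r_ideal I -> I 0.
Proof. by move=> <-; right. Qed.

Fact r_idealD I : r_ideal I -> pclosure r (I `\ 0) = I `\ 0.
Proof. by move=> rI; rewrite -r_closureD rI. Qed.

Fact nonzero_r_ideal_ex I : nonzero_r_ideal I -> exists x, (I `\ 0) x.
Proof.
move=> [rI nI]; apply: contrapT => /forallNP I0; apply: nI.
apply/seteqP; split=> [x Ix | _ ->]; last exact: r_ideal0.
by apply: contrapT => x0; case: (I0 x).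
Qed.

Definition r_ideals : Type := set_type nonzero_r_ideal.

HB.instance Definition _ := SubChoice.on r_ideals.

Fact nonzero_r_idealT : nonzero_r_ideal [set: R].
Proof.
split=> [|T0]; last first.
  by have : [set: R] 1 by []; rewrite T0 => /eqP; rewrite oner_eq0.
apply/seteqP; split=> // x _; have [-> | /eqP x0] := pselect (x = 0).
  by right.
by left; apply: pclosure_ext; [apply: nonzeroD | split=> //; apply/eqP].
Qed.

Fact nonzero_r_idealM I J : nonzero_r_ideal I -> nonzero_r_ideal J ->
  nonzero_r_ideal (r_closure (set_mul I J)).
Proof.
move=> nI nJ; split=> [|IJ0]; first exact: r_closure_ideal.
have [x Ix] := nonzero_r_ideal_ex nI; have [y Jy] := nonzero_r_ideal_ex nJ.
have: pclosure r (set_mul (I `\ 0) (J `\ 0)) (x * y).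
  apply: pclosure_ext; last by exists x => //; exists y.
  by apply: nonzero_set_mul; apply: nonzeroD.
by rewrite -set_mulD -r_closureD IJ0 => -[/= ->].
Qed.

Definition r_ideal_one : r_ideals := exist _ [set: R] (mem_set nonzero_r_idealT).

Definition r_ideal_mul (I J : r_ideals) : r_ideals :=
  exist _ (r_closure (set_mul (val I) (val J)))
    (mem_set (nonzero_r_idealM (set_mem (valP I)) (set_mem (valP J)))).

Fact r_ideals_inj (I J : r_ideals) : val I `\ 0 = val J `\ 0 -> I = J.
Proof.
move=> eqIJ; apply: val_inj.
have [rI _] := set_mem (valP I); have [rJ _] := set_mem (valP J).
by rewrite -rI -rJ; apply: r_closure_eq.
Qed.

Fact r_ideal_mulE (I J : r_ideals) : val (r_ideal_mul I J) `\ 0 =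
  pclosure r (set_mul (val I `\ 0) (val J `\ 0)).
Proof. by rewrite /= r_closureD set_mulD. Qed.

Fact r_ideal_mulC : commutative r_ideal_mul.
Proof. by move=> I J; apply: val_inj; rewrite /= set_mulC. Qed.

Fact r_ideal_mulA : associative r_ideal_mul.
Proof.
move=> I J L; rewrite [RHS]r_ideal_mulC; apply: r_ideals_inj.
rewrite 4!r_ideal_mulE !pclosure_mul; do ?[exact: nonzeroD
  | by apply: nonzero_set_mul; apply: nonzeroD].
by congr pclosure; rewrite [RHS]set_mulC set_mulA.
Qed.

Fact r_ideal_mul1 : left_id r_ideal_one r_ideal_mul.
Proof.
move=> I; apply: r_ideals_inj; rewrite r_ideal_mulE /=.
have [rI _] := set_mem (valP I).
rewrite -[RHS](r_idealD rI); congr pclosure; apply/seteqP; split; last first.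
  move=> x Ix; exists 1; last by exists x => //; rewrite mul1r.
  by split=> //; apply/eqP; rewrite oner_eq0.
move=> _ [c [_ /eqP c0] [x Ix <-]]; rewrite -(r_idealD rI).
have nx : x != 0 by apply: nonzeroD Ix.
apply: (@pclosure_mono [set x]); first exact: nonzeroD.
  by move=> _ ->.
by apply: pclosure_principal => //; exists c => //; rewrite mulrC.
Qed.

Fact r_ideal_mulr1 : right_id r_ideal_one r_ideal_mul.
Proof. by move=> I; rewrite r_ideal_mulC r_ideal_mul1. Qed.

HB.instance Definition _ :=
  isMonoid.Build r_ideals r_ideal_mulA r_ideal_mul1 r_ideal_mulr1.

Definition r_atoms : set r_ideals :=
  [set I | I <> 1%g /\
    forall J L : r_ideals, I = (J * L)%g -> J = 1%g \/ L = 1%g].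

End RIdeals.

(* Main.v *)
(* Nonzero r-ideals, ordered by inclusion, form a multiplicative lattice with
   the ascending chain condition.  Since r-max(R) = X(R), for every p in X(R)
   each I contains some p^n C with C not inside p.  Two consequences: I = (IJ)_r
   forces J = R, by comparing I with a high power of an element of a p containing
   J; and I = (I + C)(I + p^n), so that an atom inside p contains a power of p
   and has radical p.

   Let p not contain the conductor f, let a in p be nonzero, and choose b whose
   class modulo a is a nonzero socle element of R_p / a R_p; put y = b / a.  If y
   mapped p into p, then y would be almost integral, hence y in R_p because f is
   not inside p, a contradiction.  So some pi in p has u = pi y in R \ p, whence
   u p = pi C with C not inside p.  This makes p cancellative, and the only atom
   inside p is p itself.  Multiplication F(P) x T -> I_r(R) is then surjective by
   factoring into atoms, and injective by cancelling the primes in P. *)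
From HB Require Import structures.
Require Import Defs.
From mathcomp Require Import all_boot all_order all_algebra.
From mathcomp Require Import finmap multiset.
From mathcomp Require Import boolp classical_sets functions cardinality.

Set Implicit Arguments.
Unset Strict Implicit.
Unset Printing Implicit Defensive.

Local Open Scope classical_set_scope.

(** * Generated submonoids *)

Section Submonoids.

Local Open Scope group_scope.

Lemma submonoid_span1 (N : monoidType) (G : set N) : submonoid_span G 1.
Proof. exact: set_mem (submonoid_span_closed G).1. Qed.

Lemma submonoid_spanM (N : monoidType) (G : set N) (x y : N) :
  submonoid_span G x -> submonoid_span G y -> submonoid_span G (x * y).
Proof.
move=> Gx Gy; apply: set_mem.
by apply: (submonoid_span_closed G).2; apply: mem_set.
Qed.

Lemma submonoid_span_ind (N : monoidType) (G : set N) (Q : N -> Prop) :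
  Q 1 -> (forall x y, Q x -> Q y -> Q (x * y)) -> (forall x, G x -> Q x) ->
  forall x, submonoid_span G x -> Q x.
Proof.
move=> Q1 QM QG x; apply; split=> //; split; first exact: mem_set.
by move=> y z /set_mem Qy /set_mem Qz; apply/mem_set/QM.
Qed.

(** The natural map, multiplication, goes from F(P) x T to I_r(R), against the direction asked for
    in the theorem. *)
Lemma monoid_isomorphic_sym (N N' : monoidType) (f : N -> N') :
  bijective f -> monoid.monoid_morphism f -> monoid_isomorphic N' N.
Proof.
case=> g fK gK [f1 fM]; exists g; first by exists f.
split=> [|x y]; first by rewrite -f1 fK.
by apply: (can_inj fK); rewrite fM !gK.
Qed.

End Submonoids.

(** Lets [\big] products of ideals be reordered. *)
HB.instance Definition _ (R : idomainType) (r : ideal_system R) :=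
  Monoid.isComLaw.Build (r_ideals r) (r_ideal_one r) (@r_ideal_mul R r)
    (@r_ideal_mulA R r) (@r_ideal_mulC R r) (@r_ideal_mul1 R r).

(** * The multiplicative lattice of nonzero r-ideals *)

Section IdealLattice.

Import GRing.Theory.
Local Open Scope ring_scope.

Variables (R : idomainType) (r : ideal_system R).

Local Notation M := (r_ideals r).
Local Notation "I '*i' J" := (@monoid.mul M I J) 
  (at level 40, left associativity).
Local Notation "'1i'" := (@monoid.one M).
Local Notation "I '^i' n" := (@monoid.natexp M I n) (at level 30).
Local Notation "I '<=i' J" := ((val (I : M) : set R) `<=` val (J : M))
  (at level 70).

Lemma r_ideal_val (I : M) : r_ideal r (val I).
Proof. by case: (set_mem (valP I)). Qed.

Lemma mem0_ideal (I : M) : val I 0.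
Proof. exact: r_ideal0 (r_ideal_val I). Qed.

Lemma ideal_le_anti (I J : M) : I <=i J -> J <=i I -> I = J.
Proof. by move=> IJ JI; apply/val_inj/seteqP. Qed.


Lemma r_closure_min (X I : set R) :
  r_ideal r I -> X `<=` I -> r_closure r X `<=` I.
Proof.
move=> rI XI x [|->]; last exact: r_ideal0 rI.
suff: pclosure r (X `\ 0) `<=` I `\ 0 by move=> /[apply] -[].
rewrite -(r_idealD rI); apply: pclosure_mono; first exact: nonzeroD.
by move=> y [Xy y0]; split=> //; apply: XI.
Qed.

Lemma r_closure_ext (X : set R) : X `<=` r_closure r X.
Proof.
move=> x Xx; have [->|/eqP x0] := pselect (x = 0); first by right.
by left; apply: pclosure_ext; [apply: nonzeroD | split=> //; apply/eqP].
Qed.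

Lemma ideal_mulr (I : M) (x y : R) : val I x -> val I (x * y).
Proof.
move=> Ix; have [->|/eqP x0] := pselect (x = 0).
  by rewrite mul0r; apply: mem0_ideal.
have [->|/eqP y0] := pselect (y = 0).
  by rewrite mulr0; apply: mem0_ideal.
have: r_closure r [set x] `<=` val I.
  by apply: r_closure_min; [apply: r_ideal_val | move=> _ ->].
apply; left; apply: (@pclosure_mono _ _ [set x]).
- exact: nonzeroD.
- by move=> _ ->; split=> //; apply/eqP.
- by apply: pclosure_principal => //; exists y.
Qed.

Lemma ideal_mull (I : M) (x y : R) : val I y -> val I (x * y).
Proof. by rewrite mulrC; apply: ideal_mulr. Qed.

(** For nonzero y, [pclosure_scale] moves y through the closure, so y times the closure of the colon
    stays in I. For y = 0 the colon is all of R. *)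
Lemma r_ideal_colon (I : set R) (y : R) :
  r_ideal r I -> r_ideal r [set x | I (y * x)].
Proof.
move=> rI; have I0 := r_ideal0 rI.
have [->|/eqP y0] := pselect (y = 0).
  have ->: [set x : R | I (0 * x)] = [set: R].
    by apply/seteqP; split=> // x _ /=; rewrite mul0r.
  by case: (nonzero_r_idealT r).
apply/seteqP; split; last exact: r_closure_ext.
set X := [set x | _]; move=> x [|->]; last by rewrite /X /= mulr0.
move=> cx; have: ( *%R y @` pclosure r (X `\ 0)) (y * x) by exists x.
rewrite pclosure_scale //; last exact: nonzeroD.
suff: pclosure r ( *%R y @` (X `\ 0)) `<=` I `\ 0 by move=> /[apply] -[].
rewrite -(r_idealD rI); apply: pclosure_mono; first exact: nonzeroD.
move=> _ [z [Xz /eqP z0] <-]; split=> //; apply/eqP.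
by rewrite mulf_neq0.
Qed.

Lemma r_ideal_scale (I : set R) (a : R) :
  a != 0 -> r_ideal r I -> r_ideal r ( *%R a @` I).
Proof.
move=> a0 rI; apply/seteqP; split; last exact: r_closure_ext.
have E : ( *%R a @` I) `\ 0 = *%R a @` (I `\ 0).
  apply/seteqP; split.
    move=> _ [[x Ix <-] ax0]; exists x => //; split=> // x0.
    by apply: ax0; rewrite x0 /= mulr0.
  move=> _ [x [Ix /eqP x0] <-]; split; first by exists x.
  by apply/eqP; rewrite mulf_neq0.
move=> x; rewrite /r_closure E => -[|->]; last first.
  by exists 0; [exact: r_ideal0 rI | rewrite mulr0].
rewrite -pclosure_scale //; last exact: nonzeroD.
by rewrite r_idealD // => -[y [Iy _] <-]; exists y.
Qed.

Lemma subset_r_ideal (I : M) (J : set R) :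
  r_ideal r J -> val I `<=` J -> J \in nonzero_r_ideal r.
Proof.
move=> rJ IJ; apply/mem_set; split=> // J0.
have [x [Ix x0]] := nonzero_r_ideal_ex (set_mem (valP I)).
by apply: x0; move/IJ: Ix; rewrite J0.
Qed.

Fact ideal_join_subproof (I J : M) :
  r_closure r (val I `|` val J) \in nonzero_r_ideal r.
Proof.
apply: (@subset_r_ideal I); first exact: r_closure_ideal.
by apply: subset_trans (@r_closure_ext _); left.
Qed.

Definition ideal_join (I J : M) : M :=
  exist _ (r_closure r (val I `|` val J)) (ideal_join_subproof I J).

Local Notation "I '+i' J" := (ideal_join I J) (at level 50, left associativity).

Fact ideal_colon_subproof (I : M) (y : R) :
  [set x | val I (y * x)] \in nonzero_r_ideal r.
Proof.
apply: (@subset_r_ideal I); first exact: r_ideal_colon (r_ideal_val I).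
by move=> x; apply: ideal_mull.
Qed.

Definition ideal_colon (I : M) (y : R) : M :=
  exist _ [set x | val I (y * x)] (ideal_colon_subproof I y).

(* The junk value for [a = 0] is [R]. *)
Definition ideal_scale (a : R) (I : M) : M := insubd 1i ( *%R a @` val I).

Local Notation "a '*:i' I" := (ideal_scale a I) (at level 40).

Lemma val_scale (a : R) (I : M) : a != 0 -> val (a *:i I) = *%R a @` val I.
Proof.
move=> a0; rewrite val_insubd ifT //; apply/mem_set; split.
  exact: r_ideal_scale (r_ideal_val I).
have [x [Ix /eqP x0]] := nonzero_r_ideal_ex (set_mem (valP I)) => E.
have : ( *%R a @` val I) (a * x) by exists x.
by rewrite E => /eqP; rewrite mulf_eq0 (negbTE a0) (negbTE x0).
Qed.

Lemma mem_scale (a : R) (I : M) (x : R) :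
  a != 0 -> val (a *:i I) (a * x) <-> val I x.
Proof.
move=> a0; rewrite val_scale //; split; last by exists x.
by case=> y Iy /(mulfI a0) <-.
Qed.

Lemma le_joinl (I J : M) : I <=i I +i J.
Proof. by apply: subset_trans (@r_closure_ext _); left. Qed.

Lemma le_joinr (I J : M) : J <=i I +i J.
Proof. by apply: subset_trans (@r_closure_ext _); right. Qed.

Lemma join_le (I J K : M) : I <=i K -> J <=i K -> I +i J <=i K.
Proof.
move=> IK JK; apply: r_closure_min; first exact: r_ideal_val.
by move=> x [/IK|/JK].
Qed.

Lemma mul_le (I J K : M) :
  (forall x y, val I x -> val J y -> val K (x * y)) -> I *i J <=i K.
Proof.
move=> IJK; apply: r_closure_min; first exact: r_ideal_val.
by move=> _ [x Ix [y Jy <-]]; apply: IJK.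
Qed.

Lemma mem_mul (I J : M) (x y : R) : val I x -> val J y -> val (I *i J) (x * y).
Proof. by move=> Ix Jy; apply: r_closure_ext; exists x => //; exists y. Qed.

Lemma ideal_mulC (I J : M) : I *i J = J *i I.
Proof. exact: r_ideal_mulC. Qed.

Lemma ideal_mulCA (I J K : M) : I *i (J *i K) = J *i (I *i K).
Proof. by rewrite !monoid.mulgA (ideal_mulC I). Qed.

Lemma le_mul (I J K L : M) : I <=i K -> J <=i L -> I *i J <=i K *i L.
Proof. by move=> IK JL; apply: mul_le => x y /IK Kx /JL Ly; apply: mem_mul. Qed.

Lemma mul_lel (I J : M) : I *i J <=i I.
Proof. by apply: mul_le => x y Ix _; apply: ideal_mulr. Qed.

Lemma mul_ler (I J : M) : I *i J <=i J.
Proof. by rewrite ideal_mulC; apply: mul_lel. Qed.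

(** Distributivity: for x in I, the z with x z in L form an r-ideal, which contains the join once it
    contains J and K. *)
Lemma mul_join_le (I J K L : M) :
  I *i J <=i L -> I *i K <=i L -> I *i (J +i K) <=i L.
Proof.
move=> IJ IK; apply: mul_le => x y Ix.
suff: J +i K <=i ideal_colon L x by apply.
by apply: join_le => z ?; [apply: IJ | apply: IK]; apply: mem_mul.
Qed.

Lemma eq1_mem (I : M) : val I 1 -> I = 1i.
Proof.
move=> I1; apply: ideal_le_anti => // x _; rewrite -[x]mul1r.
exact: ideal_mulr.
Qed.

Lemma scale_mul (a : R) (I J : M) : a != 0 -> (a *:i I) *i J = a *:i (I *i J).
Proof.
move=> a0; apply: ideal_le_anti.
  apply: mul_le => x y; rewrite val_scale // => -[z Iz <-] Jy.
  by rewrite -mulrA; apply/mem_scale => //; apply: mem_mul.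
have IJ: I *i J <=i ideal_colon ((a *:i I) *i J) a.
  apply: mul_le => x y Ix Jy /=; rewrite mulrA; apply: mem_mul => //.
  exact/mem_scale.
by rewrite val_scale // => _ [z /IJ Iz <-].
Qed.

Lemma scale_mulr (a : R) (I J : M) : a != 0 -> I *i (a *:i J) = a *:i (I *i J).
Proof. by move=> a0; rewrite ideal_mulC scale_mul // ideal_mulC. Qed.

Lemma le_scale (a : R) (I J : M) : a != 0 -> a *:i I <=i a *:i J <-> I <=i J.
Proof.
move=> a0; split=> IJ.
  by move=> x /(mem_scale _ _ a0) /IJ /(mem_scale _ _ a0).
by rewrite !val_scale // => _ [x /IJ Jx <-]; exists x.
Qed.

(** * Noetherian induction and minimal primes *)

Hypothesis r_ring_ideal : forall I : set R, nonzero_r_ideal r I -> ring_ideal I.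
Hypothesis R_r_noetherian : r_noetherian r.
Hypothesis r_max_minimal_primes : r_max r = @minimal_primes R.

Lemma noetherian_max (F : set M) : F !=set0 ->
  exists2 I, F I & forall J, F J -> I <=i J -> J = I.
Proof.
move=> [I0 FI0]; apply: contrapT => noMax.
have /choice[f fP] : forall I, exists J, F I -> [/\ F J, I <=i J & J <> I].
  move=> I; have [FI|] := pselect (F I); last by exists I.
  apply: contrapT => /forallNP noJ; apply: noMax; exists I => // J FJ IJ.
  by apply: contrapT => JI; apply: (noJ J).
pose u n := iter n f I0.
have Fu n : F (u n) by elim: n => // n /fP[].
have [N uN] : exists N, forall n, (N <= n)%N -> val (u n) = val (u N).
  apply: (R_r_noetherian (I := fun n => val (u n))).
    by move=> n; apply: r_ideal_val.
  by move=> n; case: (fP _ (Fu n)).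
case: (fP _ (Fu N)) => _ _; apply; apply: val_inj.
exact: (uN N.+1).
Qed.

Lemma noetherian_ind (Q : M -> Prop) :
  (forall I, (forall J, I <=i J -> J <> I -> Q J) -> Q I) -> forall I, Q I.
Proof.
move=> H I; apply: contrapT => nQI.
have [J nQJ Jmax] := @noetherian_max [set J | ~ Q J] (ex_intro _ I nQI).
apply: nQJ; apply: H => L JL LJ; apply: contrapT => nQL.
by apply: LJ; apply: Jmax.
Qed.

Definition min_prime (p : M) : Prop := minimal_primes (val p).

(** Membership in [r_max] is what makes a minimal prime an r-ideal. *)
Lemma minimal_prime_lift (p : set R) :
  minimal_primes p -> exists2 q : M, min_prime q & val q = p.
Proof.
move=> mp; have := mp; rewrite -r_max_minimal_primes => -[[np _] _].
by exists (exist _ p (mem_set np)).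
Qed.

Lemma min_prime_mem (p : M) (x y : R) :
  min_prime p -> val p (x * y) -> val p x \/ val p y.
Proof.
move=> [[[_ pr] _] _] pxy.
by have /orP[/set_mem|/set_mem] := pr x y (mem_set pxy); [left|right].
Qed.

Lemma min_prime_proper (p : M) : min_prime p -> p <> 1i.
Proof.
move=> [[[[_ p1 _] _] _] _] p1E; move: p1; rewrite p1E => /negP; apply.
exact/mem_set.
Qed.

Lemma one_not_le_min_prime (p : M) : min_prime p -> ~ 1i <=i p.
Proof. by move=> pp /(_ 1 Logic.I) /(@eq1_mem p) /(min_prime_proper pp). Qed.

Lemma min_prime_maximal (p I : M) : min_prime p -> p <=i I -> I <> 1i -> I = p.
Proof.
rewrite /min_prime -r_max_minimal_primes => -[_ pmax] pI I1.
apply/val_inj/pmax => //; split; first exact: set_mem (valP I).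
by move=> IT; apply: I1; apply: val_inj.
Qed.

Lemma min_prime_eq (p q : M) : min_prime p -> min_prime q -> p <=i q -> p = q.
Proof.
move=> pp pq pleq; rewrite (min_prime_maximal pp pleq) //.
exact: min_prime_proper.
Qed.

Lemma not_leP (I J : M) : ~ I <=i J -> exists2 x, val I x & ~ val J x.
Proof.
move=> IJ; apply: contrapT => H; apply: IJ => x Ix.
by apply: contrapT => Jx; apply: H; exists x.
Qed.

Lemma min_prime_mul (p I J : M) :
  min_prime p -> I *i J <=i p -> I <=i p \/ J <=i p.
Proof.
move=> pp IJ; apply: contrapT => /not_orP[/not_leP[x Ix px] /not_leP[y Jy py]].
by have [] := min_prime_mem pp (IJ _ (mem_mul Ix Jy)).
Qed.

Lemma min_prime_pow (p I : M) (n : nat) :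
  min_prime p -> I ^i n <=i p -> I <=i p.
Proof.
move=> pp; elim: n => [|n IH].
  by move/(one_not_le_min_prime pp).
by rewrite monoid.expgS => /(min_prime_mul pp)[].
Qed.

(** A maximal proper r-ideal above I belongs to r-max(R), which is X(R). *)
Lemma le_min_prime (I : M) : I <> 1i -> exists2 p : M, min_prime p & I <=i p.
Proof.
move=> I1; have [p [p1 Ip] pmax] := @noetherian_max
  [set J | J <> 1i /\ I <=i J] (ex_intro _ I (conj I1 (fun x h => h))).
exists p => //; rewrite /min_prime -r_max_minimal_primes; split.
  split; first exact: set_mem (valP p).
  by move=> pT; apply: p1; apply: val_inj.
move=> J [nJ JT] pJ; pose J' : M := exist _ J (mem_set nJ).
suff -> : p = J' by [].
apply/esym/pmax => //; split=> [E|]; last exact: subset_trans pJ.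
by apply: JT; move/(congr1 val): E.
Qed.

(** I lies in some p of X(R); being a nonzero prime ring ideal, it equals p by minimality of p. *)
Lemma prime_min_prime (I : M) : I <> 1i ->
  (forall x y, val I (x * y) -> val I x \/ val I y) -> min_prime I.
Proof.
move=> I1 Ipr; have [p pp Ip] := le_min_prime I1.
suff -> : I = p by [].
case: pp => _ pmin; apply/val_inj/pmin => //; split; last first.
  by case: (set_mem (valP I)).
have [I0 Ilin] := r_ring_ideal (set_mem (valP I)); split; last first.
  move=> x y /set_mem /Ipr[]/mem_set Ix; apply/orP; [left|right]; exact: Ix.
by split=> //; apply/negP => /set_mem /(@eq1_mem I).
Qed.

(* That is, [I] contains a power of [p] after localization at [p]. *)
Lemma pow_coprime_le (p I : M) : min_prime p ->
  exists n (C : M), p ^i n *i C <=i I /\ ~ C <=i p.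
Proof.
move=> pp; elim/noetherian_ind: I => I IH.
have [->|I1] := pselect (I = 1i).
  by exists 0%N, 1i; split=> //; apply: one_not_le_min_prime.
(* If I is not prime, (I : b)(I + bR) lies in I and both factors are strictly larger than I, so the
   induction hypothesis applies to each. *)
have [[a [b [Iab Ia Ib]]]|nab] :=
  pselect (exists a b, [/\ val I (a * b), ~ val I a & ~ val I b]).
  have b0 : b != 0 by apply/eqP => b0; apply: Ib; rewrite b0; apply: mem0_ideal.
  have bb : val (b *:i 1i) b by rewrite -{2}[b]mulr1; apply/mem_scale.
  have [||n1 [C1 [le1 C1p]]] := IH (ideal_colon I b).
  - by move=> x Ix; apply: (@ideal_mull I).
  - by move=> E; apply: Ia; rewrite -E /= mulrC.
  have [||n2 [C2 [le2 C2p]]] := IH (I +i b *:i 1i).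
  - exact: le_joinl.
  - by move=> E; apply: Ib; rewrite -E; apply: le_joinr.
  exists (n1 + n2)%N, (C1 *i C2); split; last by move=> /(min_prime_mul pp)[].
  suff: (p ^i n1 *i C1) *i (p ^i n2 *i C2) <=i I.
    by rewrite monoid.expgnDr -!monoid.mulgA (ideal_mulCA C1).
  apply: subset_trans (le_mul le1 le2) _; apply: mul_join_le.
    exact: mul_ler.
  apply: mul_le => x y Ix; rewrite val_scale // => -[z _ <-].
  by rewrite mulrA (mulrC x); apply: ideal_mulr.
(* The remaining I is a minimal prime: it is p, or it is not inside p and serves as C. *)
have Ip : min_prime I.
  apply: prime_min_prime => // x y Ixy; apply: contrapT => /not_orP[Ix Iy].
  by apply: nab; exists x, y.
have [Ilep|nIp] := pselect (I <=i p).
  exists 1%N, 1i; rewrite monoid.expg1 monoid.mulg1.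
  rewrite (min_prime_eq Ip pp Ilep); split=> //.
  exact: one_not_le_min_prime.
by exists 0%N, I; split=> //; rewrite monoid.expg0 monoid.mul1g.
Qed.

(** * Comaximality, unit-cancellation and atoms *)

Lemma coprime_join (p C : M) n : min_prime p -> ~ C <=i p -> C +i p ^i n = 1i.
Proof.
move=> pp Cp; apply: contrapT => /le_min_prime[q pq le].
have Cq : C <=i q := subset_trans (@le_joinl _ _) le.
have /(min_prime_pow pq) plq : p ^i n <=i q := subset_trans (@le_joinr _ _) le.
by apply: Cp; rewrite (min_prime_eq pp pq plq).
Qed.

Lemma mem_pow (I : M) (x : R) n : val I x -> val (I ^i n) (x ^+ n).
Proof.
move=> Ix; elim: n => [|n IH] //.
by rewrite monoid.expgS exprS; apply: mem_mul.
Qed.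

Lemma ideal_neq0 (I : M) : exists2 x, val I x & x != 0.
Proof.
by have [x [Ix /eqP x0]] := nonzero_r_ideal_ex (set_mem (valP I)); exists x.
Qed.

(** If J were inside p, iteration would put I inside every p^n. Then x in I would, up to factors
    outside p, both divide a^N and be a multiple of a^(N+1), for some a in p. *)
Lemma mul_eq_self (I J : M) : I = I *i J -> J = 1i.
Proof.
move=> E; apply: contrapT => /le_min_prime[p pp Jp].
have Ip n : I <=i I *i p ^i n.
  elim: n => [|n IH]; first by rewrite monoid.expg0 monoid.mulg1.
  rewrite monoid.expgS monoid.mulgA; apply: subset_trans IH _.
  apply: le_mul => //.
  by rewrite {1}E; apply: le_mul.
have [x Ix x0] := ideal_neq0 I; have [a pa a0] := ideal_neq0 p.
(* N is fixed first, from x, and only then n, from a^(N+1). *)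
have [N [C' [leC' C'p]]] := pow_coprime_le (x *:i 1i) pp.
have aN0 : a ^+ N.+1 != 0 by rewrite expf_neq0.
have [n [C [leC Cp]]] := pow_coprime_le (a ^+ N.+1 *:i 1i) pp.
have [c Cc pc] := not_leP Cp; have [c' Cc' pc'] := not_leP C'p.
have : val (x *:i 1i) (a ^+ N * c').
  by apply: leC'; apply: mem_mul => //; apply: mem_pow.
rewrite val_scale // => -[z _ Ez].
have : val (a ^+ N.+1 *:i 1i) (x * c).
  apply: leC; apply: (@le_mul (I *i p ^i n) C) => //; first exact: mul_ler.
  by apply: mem_mul => //; apply: Ip.
rewrite val_scale // => -[y _ Ey].
(* From x z = a^N c' and a^(N+1) y = x c, cancelling a^N gives c' c = a y z. *)
have : val p (c' * c).
  have aN : a ^+ N != 0 by rewrite expf_neq0.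
  suff -> : c' * c = a * (y * z) by apply: ideal_mulr.
  by apply: (mulfI aN); rewrite !mulrA -exprSr Ey -Ez mulrAC.
by case/(min_prime_mem pp).
Qed.

(** In a factorization of I into proper ideals both factors are strictly larger than I, by
    [mul_eq_self], so Noetherian induction reaches the atoms. *)
Lemma atom_generation (Q : M -> Prop) : Q 1i ->
  (forall I J, Q I -> Q J -> Q (I *i J)) -> (forall I, r_atoms I -> Q I) ->
  forall I, Q I.
Proof.
move=> Q1 QM QA; elim/noetherian_ind => I IH.
have [->//|I1] := pselect (I = 1i).
have [/QA//|nA] := pselect (r_atoms I).
have [J [L [EI J1 L1]]] : exists J L, [/\ I = J *i L, J <> 1i & L <> 1i].
  apply: contrapT => H; apply: nA; split=> // J L EI.
  by apply: contrapT => /not_orP[J1 L1]; apply: H; exists J, L.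
rewrite EI; apply: QM; apply: IH; rewrite EI.
- exact: mul_lel.
- by move=> /mul_eq_self.
- exact: mul_ler.
- by rewrite ideal_mulC => /mul_eq_self.
Qed.

(** Write I = I (J + K): both I J and I K lie in (I + J)(I + K). Conversely, each of the four
    partial products lies in I. *)
Lemma eq_mul_coprime (I J K : M) : J +i K = 1i -> J *i K <=i I ->
  I = (I +i J) *i (I +i K).
Proof.
move=> JK1 JKI; apply: ideal_le_anti.
  rewrite -{1}[I]monoid.mulg1 -JK1; apply: mul_join_le.
    by rewrite ideal_mulC; apply: le_mul; [apply: le_joinr|apply: le_joinl].
  by apply: le_mul; [apply: le_joinl|apply: le_joinr].
apply: mul_join_le; first exact: mul_ler.
by rewrite ideal_mulC; apply: mul_join_le; [exact: mul_ler|rewrite ideal_mulC].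
Qed.

Lemma atom_primary (p I : M) : min_prime p -> r_atoms I -> I <=i p ->
  exists n, p ^i n <=i I.
Proof.
move=> pp [I1 IA] Ip; have [n [C [le Cp]]] := pow_coprime_le I pp.
have EI : I = (I +i C) *i (I +i p ^i n).
  by apply: eq_mul_coprime; [exact: coprime_join|rewrite ideal_mulC].
exists n; have [E|E] := IA _ _ EI.
- by rewrite EI E monoid.mul1g; apply: le_joinr.
(* For n = 0 the equation I + p^0 = R is no contradiction by itself; it comes from C inside I inside
   p. For n > 0 both I and p^n are inside p. *)
- case: n E le {EI} => [_|n E _].
    rewrite monoid.expg0 monoid.mul1g => CI; case: Cp.
    exact: subset_trans Ip.
  case: (one_not_le_min_prime pp); rewrite -E.
  by apply: join_le => //; rewrite monoid.expgS; apply: mul_lel.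
Qed.

Lemma radical_atom (p I : M) : min_prime p -> r_atoms I -> I <=i p ->
  radical (val I) = val p.
Proof.
move=> pp IA Ip; have [n pnI] := atom_primary pp IA Ip.
apply/seteqP; split=> [x [k _ /Ip pxk]|x px].
  elim: k pxk => [|k IH].
    by rewrite expr0 => /eq1_mem /(min_prime_proper pp).
  by rewrite exprS => /(min_prime_mem pp)[].
exists n.+1 => //; rewrite exprS; apply: ideal_mull; apply: pnI.
exact: mem_pow.
Qed.

Lemma atom_min_prime (I : M) : r_atoms I ->
  exists p : M, [/\ min_prime p, I <=i p & radical (val I) = val p].
Proof.
move=> IA; have [p pp Ip] := le_min_prime IA.1.
by exists p; split=> //; apply: radical_atom.
Qed.

(** * Primes not containing the conductor *)

Lemma complete_integral_closure1 : @complete_integral_closure R 1.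
Proof.
by exists 1; [exact: oner_neq0 | move=> n; exists 1; rewrite // expr1n mulr1].
Qed.

(** The colon stands for the fractional multiple (u/v) I, which lies in R by the inclusion
    assumed. *)
Lemma scale_colon (u v : R) (I : M) : u != 0 -> v != 0 ->
  u *:i I <=i v *:i 1i -> v *:i ideal_colon (u *:i I) v = u *:i I.
Proof.
move=> u0 v0 le; apply: ideal_le_anti.
  by rewrite {1}val_scale // => _ [x Ix <-].
move=> x Ix; move: (le x Ix); rewrite val_scale // => -[z _ E].
by rewrite -E; apply/mem_scale => //=; rewrite E.
Qed.

Section NotOverConductor.

Variable p : M.
Hypothesis pp : min_prime p.

(* [b] represents a nonzero class of the socle of [R_p / a R_p]. *)
Lemma exists_socle (a : R) : a != 0 -> val p a ->
  exists2 b : R, (forall x, val p x -> exists w, x * b = a * w) &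
    forall t, ~ val p t -> forall w, t * b <> a * w.
Proof.
move=> a0 pa; set A := a *:i 1i.
have AP x : val A x <-> exists w, x = a * w.
  by rewrite val_scale //; split=> [[w _ <-]|[w ->]]; exists w.
(* [Q n] says that p^n lies in aR after localization at p; k is an exponent where this fails while
   it holds at k + 1. *)
pose Q n := exists2 C : M, p ^i n *i C <=i A & ~ C <=i p.
have [k nQk [C leC Cp]] : exists2 k, ~ Q k & Q k.+1.
  have [n [C [leC Cp]]] := pow_coprime_le A pp.
  have Qn : Q n by exists C.
  have nQ0 : ~ Q 0%N.
    move=> [C0]; rewrite monoid.expg0 monoid.mul1g => C0A; apply.
    apply: subset_trans C0A _ => x /AP[w ->]; exact: ideal_mulr.
  elim: n {leC} Qn => [//|n IH Qn].
  by have [/IH|] := pselect (Q n); last exists n.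
have [b Cb bA] : exists2 b, val (p ^i k *i C) b &
    forall t, ~ val p t -> ~ val A (t * b).
  apply: contrapT => H.
  have p1 : ~ val p 1 by move/eq1_mem/(min_prime_proper pp).
  (* A single s outside p must send all of p^k C into A. Choosing (A : s) maximal achieves this,
     since then (A : t s) = (A : s) for every t outside p. *)
  have [_ [s ps ->] smax] := @noetherian_max
    [set J | exists2 t, ~ val p t & J = ideal_colon A t]
    (ex_intro _ _ (ex_intro2 _ _ 1 p1 erefl)).
  have s0 : s != 0 by apply/eqP => s0; apply: ps; rewrite s0; exact: mem0_ideal.
  apply: nQk; exists (s *:i C).
    rewrite scale_mulr // val_scale // => _ [b Cb <-].
    have [t pt Atb] : exists2 t, ~ val p t & val A (t * b).
      apply: contrapT => Ht; apply: H; exists b => // t pt Atb.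
      by apply: Ht; exists t.
    suff: val (ideal_colon A s) b by [].
    rewrite -(smax (ideal_colon A (t * s))) /=.
    - by rewrite mulrAC; apply: ideal_mulr.
    - by exists (t * s) => // /(min_prime_mem pp)[].
    - by move=> x Ax /=; rewrite -mulrA; apply: ideal_mull.
  have [c Cc pc] := not_leP Cp.
  by move=> /(_ (s * c) (proj2 (mem_scale _ _ s0) Cc)) /(min_prime_mem pp)[].
exists b => [x px|t pt w E].
  by apply/AP/leC; rewrite monoid.expgS -monoid.mulgA; apply: mem_mul.
by apply: (bA t pt); apply/AP; exists w.
Qed.

Hypothesis p_conductor : ~ (@conductor R `<=` (@tofrac R) @` val p).

(* Hence [p R_p = pi R_p], and [p] is locally principal. *)
Lemma exists_uniformizer : exists pi u (C : M),
  [/\ pi != 0, u != 0, pi *:i C = u *:i p & ~ C <=i p].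
Proof.
have [a pa a0] := ideal_neq0 p; have [b pb nb] := exists_socle a0 pa.
have fa0 : tofrac a != 0 by rewrite tofrac_eq0.
have [[pi [u [ppi E pu]]]|H] :=
  pselect (exists pi u, [/\ val p pi, pi * b = a * u & ~ val p u]).
  have u0 : u != 0 by apply/eqP => u0; apply: pu; rewrite u0; exact: mem0_ideal.
  have pi0 : pi != 0.
    apply/eqP => pi0; move/eqP: E; rewrite pi0 mul0r eq_sym mulf_eq0.
    by rewrite (negbTE a0) (negbTE u0).
  (* C is (u/pi) p. It lies in R because p b is in aR and pi b = a u; it contains u because pi is in
     p. *)
  exists pi, u, (ideal_colon (u *:i p) pi); split=> //.
    apply: scale_colon => //; rewrite val_scale // => _ [x /pb[w Ew] <-].
    have -> : u * x = pi * w; last by apply/mem_scale.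
    by apply: (mulfI a0); rewrite mulrA -E mulrAC -mulrA Ew mulrCA.
  move=> /(_ u) H; apply: pu; apply: H => /=; rewrite mulrC.
  exact/mem_scale.
(* Otherwise b/a maps p into p, so a (b/a)^n stays in p and b/a is almost integral. A conductor
   element outside p then multiplies b into aR, against the choice of b. *)
case: p_conductor => phi cphi.
(* Testing phi on 1 shows that it comes from an element f of R. *)
have [f _ Ef] := cphi _ complete_integral_closure1.
rewrite mulr1 in Ef; exists f => //; apply: contrapT => pf.
have [z _ Ez] : range (@tofrac R) (phi * (tofrac b / tofrac a)).
  apply: cphi; exists a => // n.
  suff [w _ ->] : exists2 w, val p w &
      tofrac a * (tofrac b / tofrac a) ^+ n = tofrac w.
    by exists w.
  elim: n => [|n [w pw Ew]]; first by exists a => //; rewrite mulr1.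
  have [w' Ew'] := pb w pw; exists w'.
    by apply: contrapT => pw'; apply: H; exists w, w'.
  by rewrite exprSr mulrA Ew mulrA -tofracM Ew' tofracM mulrAC mulfV // mul1r.
apply: (nb f pf z); apply/eqP; rewrite -tofrac_eq !tofracM Ez Ef.
by rewrite mulrCA [X in _ == _ * X]mulrC mulfVK.
Qed.

(** Multiply by u, replace u p by pi C and cancel pi: C J lies in C L. Then J = J (C + p) lies in
    L. *)
Lemma mul_le_cancel (J L : M) : p *i J <=i p *i L -> J <=i L.
Proof.
have [pi [u [C [pi0 u0 E Cp]]]] := exists_uniformizer => le.
have leC : C *i J <=i C *i L.
  apply/(le_scale _ _ pi0); rewrite -!scale_mul // E !scale_mul //.
  exact/le_scale.
rewrite -{1}[J]monoid.mulg1 -(coprime_join 1 pp Cp); apply: mul_join_le.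
  by rewrite ideal_mulC; apply: subset_trans leC (@mul_ler _ _).
by rewrite monoid.expg1 ideal_mulC; apply: subset_trans le (@mul_ler _ _).
Qed.

Lemma mul_cancel (J L : M) : p *i J = p *i L -> J = L.
Proof. by move=> E; apply: ideal_le_anti; apply: mul_le_cancel; rewrite E. Qed.

(** p divides I: with I' = (u/pi) I one has I C = p I', and C + p^n = R turns this into I = p (I' +
    p^n). *)
Lemma atom_eq_prime (I : M) : r_atoms I -> I <=i p -> I = p.
Proof.
have [pi [u [C [pi0 u0 E Cp]]]] := exists_uniformizer => IA Ip.
have [n pnI] := atom_primary pp IA Ip.
pose I' := ideal_colon (u *:i I) pi.
have EI' : pi *:i I' = u *:i I.
  apply: scale_colon => //; apply: (@subset_trans _ (val (u *:i p))).
    exact/le_scale.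
  by rewrite -E; apply/le_scale.
have EIC : I *i C = p *i I'.
  by apply: ideal_le_anti; apply/(le_scale _ _ pi0);
    rewrite -!scale_mulr // E EI' !scale_mulr // ideal_mulC.
have EI : I = p *i (I' +i p ^i n).
  apply: ideal_le_anti.
    rewrite -{1}[I]monoid.mulg1 -(coprime_join n pp Cp); apply: mul_join_le.
      by rewrite EIC; apply: le_mul => //; apply: le_joinl.
    by apply: le_mul => //; apply: le_joinr.
  apply: mul_join_le; first by rewrite -EIC; apply: mul_lel.
  by apply: subset_trans pnI; apply: mul_ler.
have [/(min_prime_proper pp)//|E1] := IA.2 _ _ EI.
by rewrite EI E1 monoid.mulg1.
Qed.

End NotOverConductor.

(** * The isomorphism of F(P) x T with I_r(R) *)

Definition regular_primes : set (set R) :=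
  [set p | minimal_primes p /\ ~ (@conductor R `<=` (@tofrac R) @` p)].

Definition singular_atoms : set M :=
  [set I | r_atoms I /\
    (@minimal_primes R `\` regular_primes) (radical (val I))].

Fact regular_prime_subproof (q : regular_primes) : nonzero_r_ideal r (val q).
Proof.
have [/minimal_prime_lift[p _ <-] _] := set_mem (valP q).
exact: set_mem (valP p).
Qed.

Definition regular_prime (q : regular_primes) : M :=
  exist _ (val q) (mem_set (regular_prime_subproof q)).

Lemma regular_prime_min (q : regular_primes) : min_prime (regular_prime q).
Proof. by case: (set_mem (valP q)). Qed.

Lemma regular_prime_conductor (q : regular_primes) :
  ~ (@conductor R `<=` (@tofrac R) @` val (regular_prime q)).
Proof. by case: (set_mem (valP q)). Qed.

Lemma regular_prime_inj (p q : regular_primes) :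
  regular_prime p <=i regular_prime q -> p = q.
Proof.
move=> /(min_prime_eq (regular_prime_min p) (regular_prime_min q)) E.
by apply: val_inj; move/(congr1 val): E.
Qed.

(** Sequences allow induction; multisets enter through [enum_mset]. *)
Definition prime_product (S : seq regular_primes) : M :=
  \big[@r_ideal_mul R r/@r_ideal_one R r]_(q <- S) regular_prime q.

Lemma prime_product_cons q S :
  prime_product (q :: S) = regular_prime q *i prime_product S.
Proof. by rewrite /prime_product big_cons. Qed.

Lemma prime_product_cat S S' :
  prime_product (S ++ S') = prime_product S *i prime_product S'.
Proof. by rewrite /prime_product big_cat. Qed.

Lemma prime_product_cancel S (J L : M) :
  prime_product S *i J = prime_product S *i L -> J = L.
Proof.
elim: S => [|q S IH]; first by rewrite /prime_product big_nil !monoid.mul1g.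
rewrite prime_product_cons -!monoid.mulgA => E; apply: IH.
apply: mul_cancel E; first exact: regular_prime_min.
exact: regular_prime_conductor.
Qed.

(** Distinct minimal primes are incomparable, so the factors other than q have a product not inside
    q. *)
Lemma prime_product_split q S : exists2 X : M,
  prime_product S = regular_prime q ^i count_mem q S *i X &
  ~ X <=i regular_prime q.
Proof.
have pq := regular_prime_min q.
elim: S => [|p S [X E Xq]].
  exists 1i; first by rewrite /prime_product big_nil monoid.mulg1.
  exact: one_not_le_min_prime.
rewrite prime_product_cons E /=; have [->|pq'] := eqVneq p q.
  by exists X => //; rewrite add1n monoid.expgS monoid.mulgA.
exists (regular_prime p *i X); first by rewrite ideal_mulCA.
move=> /(min_prime_mul pq)[/regular_prime_inj pqE|//].
by rewrite pqE eqxx in pq'.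
Qed.

(** A singular atom inside q would have radical q, which is regular; primality of q extends this to
    products. *)
Lemma singular_span_not_le q (t : M) :
  submonoid_span singular_atoms t -> ~ t <=i regular_prime q.
Proof.
have pq := regular_prime_min q.
apply: (@submonoid_span_ind _ _ (fun t : M => ~ t <=i regular_prime q)).
- exact: one_not_le_min_prime.
- by move=> I J Iq Jq /(min_prime_mul pq)[].
move=> I [IA [_ nreg]] Iq; apply: nreg; rewrite (radical_atom pq IA Iq).
exact: set_mem (valP q).
Qed.

(** An excess of q on the right survives cancelling the power of q on the left. Then X t would lie
    in q, while neither X nor t does. *)
Lemma count_le_of_product_eq S S' (t t' : M) q :
  submonoid_span singular_atoms t ->
  prime_product S *i t = prime_product S' *i t' ->
  (count_mem q S' <= count_mem q S)%N.
Proof.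
move=> At E; have pq := regular_prime_min q.
have [X EX Xq] := prime_product_split q S.
have [X' EX' _] := prime_product_split q S'.
rewrite leqNgt; apply/negP => lt.
have {E} : X *i t =
    regular_prime q ^i (count_mem q S' - count_mem q S) *i (X' *i t').
  apply: (@prime_product_cancel (nseq (count_mem q S) q)).
  have -> : prime_product (nseq (count_mem q S) q) =
      regular_prime q ^i (count_mem q S).
    elim: (count_mem q S) => [|n IH]; first by rewrite /prime_product big_nil.
    by rewrite prime_product_cons IH monoid.expgS.
  rewrite !monoid.mulgA -monoid.expgnDr subnKC ?(ltnW lt) // -EX.
  by rewrite -EX' E.
rewrite -(subnSK lt) monoid.expgS -monoid.mulgA => E.
have : X *i t <=i regular_prime q by rewrite E; apply: mul_lel.
by move/(min_prime_mul pq) => [//|]; apply: singular_span_not_le.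
Qed.

Definition product_map
    (x : free_abelian_monoid regular_primes * submonoid singular_atoms) : M :=
  prime_product (enum_mset x.1) *i val x.2.

Lemma product_map_inj : injective product_map.
Proof.
move=> [S t] [S' t']; rewrite /product_map /= => E.
have At := set_mem (valP t); have At' := set_mem (valP t').
have ES : S = S'.
  apply/msetP => q; rewrite -!count_mem_mset; apply/eqP; rewrite eqn_leq.
  apply/andP; split; last exact: count_le_of_product_eq At E.
  exact: count_le_of_product_eq At' (esym E).
by subst S'; congr pair; apply/val_inj/(prime_product_cancel E).
Qed.

Lemma prime_productD (S S' : multiset regular_primes) :
  prime_product (enum_mset (msetD S S')) =
  prime_product (enum_mset S) *i prime_product (enum_mset S').
Proof.
rewrite -prime_product_cat; apply: perm_big; apply/allP => q _ /=.
by rewrite count_cat !count_mem_mset msetE2.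
Qed.

Lemma product_map_morphism : monoid.monoid_morphism product_map.
Proof.
split.
  by rewrite /product_map /= enum_mset0 /prime_product big_nil monoid.mulg1.
move=> [S t] [S' t']; rewrite /product_map /= prime_productD -!monoid.mulgA.
by congr monoid.mul; rewrite ideal_mulCA.
Qed.

Lemma product_map_surj (I : M) : exists x, product_map x = I.
Proof.
have [one_map mul_map] := product_map_morphism.
elim/atom_generation: I => [|I J [x <-] [y <-]|I IA]; first by exists 1%g.
  by exists (x * y)%g.
have [p [pp Ip radI]] := atom_min_prime IA.
(* An atom inside a prime of P is that prime; any other atom is a generator of T. *)
have [pR|pR] := pselect (regular_primes (val p)).
  pose q : regular_primes := exist _ (val p) (mem_set pR).
  exists ([mset q]%mset, 1%g); rewrite /product_map /= enum_msetn monoid.mulg1.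
  rewrite /prime_product big_seq1 (atom_eq_prime pp pR.2 IA Ip).
  exact: val_inj.
have AI : submonoid_span singular_atoms I.
  apply: sub_gen_smallest; split=> //; rewrite radI; split=> //.
exists (1%g, exist _ I (mem_set AI)).
by rewrite /product_map /= enum_mset0 /prime_product big_nil monoid.mul1g.
Qed.

Lemma r_ideals_isomorphic : monoid_isomorphic M
  (free_abelian_monoid regular_primes * submonoid singular_atoms)%type.
Proof.
have [g gK] : exists g, cancel g product_map.
  by have [g gK] := choice product_map_surj; exists g.
apply: (@monoid_isomorphic_sym _ _ product_map) => //.
- by exists g => // x; apply: product_map_inj.
- exact: product_map_morphism.
Qed.

(** * Unit-cancellation and finite generation of T *)

Lemma singular_monoid_unit_cancellative :
  unit_cancellative_monoid (submonoid singular_atoms).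
Proof.
split=> [x y|a u E]; first by apply: val_inj; apply: ideal_mulC.
(* Here u is itself the identity, so 1 is its inverse. *)
exists 1%g; rewrite monoid.mulg1; apply: val_inj.
by apply: (@mul_eq_self (val a)); rewrite {1}E.
Qed.

(** An atom that is a product of elements of G is in G, since one factor of any factorization is R.
    The converse only transfers the generators to the subtype. *)
Lemma singular_monoid_fg :
  finitely_generated (submonoid singular_atoms) <-> finite_set singular_atoms.
Proof.
split=> [[G finG spanG]|finA].
  apply: sub_finite_set (finite_image val finG) => I AI.
  have Is : submonoid_span singular_atoms I by apply: sub_gen_smallest.
  pose x : submonoid singular_atoms := exist _ I (mem_set Is).
  suff Gx : G x by exists x.
  have : submonoid_span G x by rewrite spanG.
  move: AI.1; rewrite -[I]/(val x); move: x; clear=> x /[swap].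
  apply: (@submonoid_span_ind _ _ (fun x => r_atoms (val x) -> G x)) => //.
    by case.
  move=> y z Gy Gz yzA; have [_ /(_ (val y) (val z) erefl)[E|E]] := yzA.
    have -> : (y * z = z)%g by apply: val_inj; rewrite /= E monoid.mul1g.
    by apply: Gz; move: yzA; rewrite /= E monoid.mul1g.
  have -> : (y * z = y)%g by apply: val_inj; rewrite /= E monoid.mulg1.
  by apply: Gy; move: yzA; rewrite /= E monoid.mulg1.
(* The default value 1 is taken only off the span. *)
pose inc (I : M) : submonoid singular_atoms := insubd 1%g I.
have incE I : submonoid_span singular_atoms I -> val (inc I) = I.
  by move=> sI; rewrite val_insubd mem_set.
exists (inc @` singular_atoms); first exact: finite_image.
apply/seteqP; split=> // x _.
suff H I : submonoid_span singular_atoms I ->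
    submonoid_span (inc @` singular_atoms) (inc I).
  have -> : x = inc (val x).
    by apply: val_inj; rewrite incE //; exact: set_mem (valP x).
  by apply: H; exact: set_mem (valP x).
(* Span membership is carried through the induction because [incE] requires it of both factors. *)
move=> sI; suff [] : submonoid_span singular_atoms I /\
  submonoid_span (inc @` singular_atoms) (inc I) by [].
apply: (@submonoid_span_ind _ _ (fun I => submonoid_span singular_atoms I /\
  submonoid_span (inc @` singular_atoms) (inc I))) sI.
- have s1 : submonoid_span singular_atoms (1%g : M) by exact: submonoid_span1.
  split=> //; have -> : inc 1%g = 1%g by apply: val_inj; rewrite incE.
  exact: submonoid_span1.
- move=> J L [sJ iJ] [sL iL]; have sJL := submonoid_spanM sJ sL; split=> //.
  have -> : inc (J * L)%g = (inc J * inc L)%g.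
    by apply: val_inj; rewrite /= !incE.
  exact: submonoid_spanM.
- by move=> J AJ; split; apply: sub_gen_smallest => //; exists J.
Qed.

End IdealLattice.

Theorem theorem4p8 (R : idomainType) (r : ideal_system R)
    (r_ring_ideal : forall I : set R, nonzero_r_ideal r I -> ring_ideal I)
    (conductor_nonzero : @conductor R <> [set 0%R])
    (R_r_noetherian : r_noetherian r)
    (r_max_minimal_primes : r_max r = @minimal_primes R) :
  let P : set (set R) :=
    [set p | minimal_primes p /\ ~ (@conductor R `<=` (@tofrac R) @` p)] in
  let Pstar : set (set R) := @minimal_primes R `\` P in
  let A : set (r_ideals r) :=
    [set I | r_atoms I /\ Pstar (radical (val I))] in
  let T : monoidType := submonoid A in
  (unit_cancellative_monoid T /\
   monoid_isomorphic (r_ideals r) (free_abelian_monoid P * T)%type) /\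
  (finitely_generated T <-> finite_set A).
Proof.
split; first split.
- exact: singular_monoid_unit_cancellative.
- exact: r_ideals_isomorphic.
- exact: singular_monoid_fg.
Qed.
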